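(* Let $[a,b]$ be a finite interval, let $W$ be a $p\times p$ weight matrix function on $[a,b]$, and let $F$ and $G$ be continuous $p\times p$ real matrix functions on $[a,b]$. For $n\ge1$ let $x_1^{(n)},\dots,x_k^{(n)}$ ($k=k(n)$) be the distinct zeros of the orthonormal matrix polynomial $P_n(x)$ on $[a,b]$ with respect to $W$, and let $\Lambda_1^{(n)},\dots,\Lambda_k^{(n)}$ be the corresponding Gaussian quadrature coefficients. Then $$\int_a^bF(x)\,W(x)\,G(x)^T\,dx=\lim_{n\to\infty}\sum_{i=1}^kF(x_i^{(n)})\,\Lambda_i^{(n)}\,G(x_i^{(n)})^T.$$
   Context: A weight matrix function on $[a,b]$ is a symmetric $p\times p$ real matrix-valued function $W(x)$, integrable over $[a,b]$, such that $W(x)\ge 0$ (positive semidefinite) and $\det W(x)\ne 0$ almost everywhere on $[a,b]$; it is normalized by $\int_a^bW(x)\,dx=I$. The orthonormal matrix polynomials $P_n(x)$, with coefficients in $\mathbb{R}^{p\times p}$, satisfy $\int_a^bP_n(x)W(x)P_m(x)^T\,dx=\delta_{n,m}I$; $P_n$ has degree $n$ and non-singular leading coefficient, and is determined up to left multiplication by an orthogonal matrix. Integrals of matrix functions are taken entrywise. A zero of $P_n$ is a point $x_0$ with $\det P_n(x_0)=0$, and its multiplicity is its multiplicity as a root of $\det P_n$. The zeros of $P_n$ are real and lie in $[a,b]$. If $x_i=x_i^{(n)}$ is a zero of multiplicity $m_i$, there are $m_i$ linearly independent vectors $v_{i,1},\dots,v_{i,m_i}\in\mathbb{R}^p$ with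 $P_n(x_i)v_{i,j}=0$. The Gaussian quadrature coefficients are $$\Lambda_i^{(n)}=(v_{i,1}\ \cdots\ v_{i,m_i})\,L_i^{-1}\begin{pmatrix} v_{i,1}^T\\ \vdots\\ v_{i,m_i}^T\end{pmatrix},\qquad L_i=\begin{pmatrix} v_{i,1}^T\\ \vdots\\ v_{i,m_i}^T\end{pmatrix}K_{n-1}(x_i,x_i)\,(v_{i,1}\ \cdots\ v_{i,m_i}),$$ where $K_{n-1}(x,y)=\sum_{j=0}^{n-1}P_j(y)^TP_j(x)$; the matrices $L_i$ are symmetric positive definite. *)

(* Defs.v *)
From HB Require Import structures.
From mathcomp Require Import all_boot all_order all_algebra.
From mathcomp Require Import all_classical all_reals all_analysis.

Set Implicit Arguments.
Unset Strict Implicit.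
Unset Printing Implicit Defensive.

Import Order.TTheory GRing.Theory Num.Theory.
Import numFieldNormedType.Exports.

Local Open Scope classical_set_scope.
Local Open Scope ring_scope.

Section Defs.
Context {R : realType} {p : nat}.
Implicit Types (a b x y : R) (W : R -> 'M[R]_p) (P : nat -> 'M[{poly R}]_p).

(* Integrals are taken with respect to the completed Lebesgue measure, so that
   [W] may be any Lebesgue measurable function, not only a Borel one. *)
Definition mxintegral a b (f : R -> 'M[R]_p) : 'M[R]_p :=
  \matrix_(i, j) \int[completed_lebesgue_measure]_(t in `[a, b]) f t i j.

Definition psdmx (A : 'M[R]_p) : Prop :=
  forall v : 'cV[R]_p, 0 <= (v^T *m A *m v) 0 0.

Record weight_matrix a b W : Prop := WeightMatrix {
  weight_sym : forall x, x \in `[a, b] -> (W x)^T = W x;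
  weight_integrable : forall i j,
    completed_lebesgue_measure.-integrable `[a, b] (fun x => (W x i j)%:E);
  weight_psd_ae :
    {ae completed_lebesgue_measure, forall x, x \in `[a, b] ->
       psdmx (W x) /\ \det (W x) != 0};
  weight_normalized : mxintegral a b W = 1%:M }.

(* Matrix polynomials are encoded as matrices with polynomial entries, so that
   [\det A] is the determinant as a scalar polynomial. *)
Definition mxpeval (A : 'M[{poly R}]_p) x : 'M[R]_p :=
  map_mx (fun q : {poly R} => q.[x]) A.

Definition mxpcoef (A : 'M[{poly R}]_p) n : 'M[R]_p :=
  map_mx (fun q : {poly R} => q`_n) A.

Record orthonormal_mxpoly a b W P : Prop := OrthonormalMxpoly {
  onp_degree : forall n i j, (size (P n i j) <= n.+1)%N;
  onp_lead : forall n, mxpcoef (P n) n \in unitmx;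
  onp_orthonormal : forall n m,
    mxintegral a b (fun x => mxpeval (P n) x *m W x *m (mxpeval (P m) x)^T)
    = (n == m)%:R%:M }.

Definition kernel_mx P n x y : 'M[R]_p :=
  \sum_(j < n.+1) (mxpeval (P j) y)^T *m mxpeval (P j) x.

Definition zero_mult P n x : nat := mup x (\det (P n)).

(* The columns of [V] are linearly independent null vectors of P_n(x), as many
   as the multiplicity of [x] as a zero of P_n. *)
Definition zero_vectors P n x (V : 'M[R]_(p, zero_mult P n x)) : Prop :=
  mxpeval (P n) x *m V = 0 /\ \rank V = zero_mult P n x.

Definition gauss_coef P n x m (V : 'M[R]_(p, m)) : 'M[R]_p :=
  V *m invmx (V^T *m kernel_mx P n.-1 x x *m V) *m V^T.

End Defs.

(* Main.v *)
(* Put L_ij(q) = int q W_ij. The orthonormality of (P_n) is a purely algebraic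
   statement about the symmetric array of linear functionals L. Multiplication
   by X, compressed to degree < n, acts in the orthonormal basis P_0, ...,
   P_(n-1) as a symmetric block matrix, and the vectors (P_r(x) v)_r with
   P_n(x) v = 0 are its eigenvectors for the eigenvalue x. Hence complex zeros
   of det P_n are real, zeros lie in [a, b] because a <= X <= b in the weighted
   form, and eigenvectors at distinct zeros are orthogonal. So
   E_rs = sum_i P_r(x_i) Lambda_i P_s(x_i)^T is an orthogonal projection, whose
   trace is the total multiplicity n p of the zeros, i.e. E is the identity.
   This makes the quadrature exact on scalar polynomials of degree < n.
   The coefficients are positive semidefinite and sum to the identity, so
   sum_i |(Lambda_i)_jk| <= 1, and the convergence for continuous functions
   follows, entry by entry, from Weierstrass' approximation theorem. *)
Require Import Defs.
From HB Require Import structures.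
From mathcomp Require Import all_boot all_order all_algebra fingroup perm.
From mathcomp Require Import ring lra complex.
From mathcomp Require Import all_classical all_reals all_analysis.
From mathcomp Require Import measurable_realfun.

Set Implicit Arguments.
Unset Strict Implicit.
Unset Printing Implicit Defensive.

Import Order.TTheory GRing.Theory Num.Theory.
Import numFieldNormedType.Exports.

Local Open Scope classical_set_scope.
Local Open Scope ring_scope.

(** * Polynomials *)

Section LeadingCoefficients.
Variable R : comNzRingType.
Implicit Types q r : {poly R}.

Lemma coefM_top m n q r : (size q <= m.+1)%N -> (size r <= n.+1)%N ->
  (q * r)`_(m + n) = q`_m * r`_n.
Proof.
move=> sq sr; have lt_m : (m < (m + n).+1)%N by rewrite ltnS leq_addr.
rewrite coefM (bigD1 (Ordinal lt_m)) //= addKn big1 ?addr0 // => i ne_im.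
have [lt_im | gt_im | eq_im] := ltngtP i m.
- by rewrite [r`_(_)]nth_default ?mulr0 // (leq_trans sr) // ltn_subRL ltn_add2r.
- by rewrite [q`_(_)]nth_default ?mul0r // (leq_trans sq).
by case/eqP: ne_im; apply: val_inj.
Qed.

Lemma coef_prod_top (I : Type) (s : seq I) (f : I -> {poly R}) n :
    (forall i, (size (f i) <= n.+1)%N) ->
  (\prod_(i <- s) f i)`_(size s * n) = \prod_(i <- s) (f i)`_n
  /\ (size (\prod_(i <- s) f i)%R <= (size s * n).+1)%N.
Proof.
move=> sf; elim: s => [|i s [IHc IHs]].
  by rewrite !big_nil coef1 size_poly1.
rewrite !big_cons mulSn coefM_top // IHc; split=> //.
apply: leq_trans (size_polyMleq _ _) _.
by rewrite -subn1 leq_subLR add1n -addSn -addnS leq_add.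
Qed.

(** Each Leibniz term is a product of p entries of degree at most n, so its coefficient of degree pn
    is the product of the entries' coefficients of degree n. *)
Lemma coef_det_top p (A : 'M[{poly R}]_p) n :
    (forall i j, (size (A i j) <= n.+1)%N) ->
  (\det A)`_(p * n) = \det (map_mx (fun q => q`_n) A).
Proof.
move=> sA; rewrite /determinant coef_sum; apply: eq_bigr => /= s _.
rewrite -(rmorph1 polyC) -rmorphN -rmorphXn coefCM; congr (_ * _).
have [+ _] := coef_prod_top (enum 'I_p) (fun i => sA i ((s : {perm _}) i)).
by rewrite size_enum_ord !big_enum /= => ->; apply: eq_bigr => i _; rewrite mxE.
Qed.

End LeadingCoefficients.

(** * Real-rooted polynomials and the count of their zeros *)

Section SplitPolynomials.
Variable R : rcfType.

(** The polynomial factors over [R[i]]; its roots equal their real parts, and the factorization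
    descends because the embedding of coefficients is injective. *)
Lemma real_rooted_splits (q : {poly R}) :
    q != 0 ->
    (forall z : R[i], root (map_poly (real_complex R) q) z -> complex.Im z = 0) ->
  {rs : seq R | q = lead_coef q *: \prod_(x <- rs) ('X - x%:P)}.
Proof.
move=> q0 q_real.
have [zs def_q] := closed_field_poly_normal (map_poly (real_complex R) q).
exists [seq complex.Re z | z <- zs].
apply: (map_poly_inj (real_complex R)); rewrite def_q.
rewrite linearZ /= lead_coef_map; congr (_ *: _).
rewrite rmorph_prod big_map; apply: eq_big_seq => z zs_z.
rewrite rmorphB /= map_polyX map_polyC /=; congr (_ - _%:P).
have /q_real : root (map_poly (real_complex R) q) z.
  rewrite def_q rootZ ?lead_coef_eq0 ?map_poly_eq0 //.
  by rewrite root_prod_XsubC.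
by case: z {zs_z} => x y /= ->.
Qed.

(** The multiplicity of x is its number of occurrences in [rs]. Exchanging the sums counts each
    member of [rs] once, since [zs] lists every root exactly once. *)
Lemma sum_mup_splits (q : {poly R}) (rs zs : seq R) :
    q != 0 -> q = lead_coef q *: \prod_(x <- rs) ('X - x%:P) ->
    uniq zs -> (forall x, (x \in zs) = root q x) ->
  (\sum_(x <- zs) mup x q = (size q).-1)%N.
Proof.
move=> q0 def_q zs_uniq zsE.
have c0 : lead_coef q != 0 by rewrite lead_coef_eq0.
have mupE x : mup x q = count_mem x rs.
  rewrite def_q -mul_polyC mupMr ?mu_prod_XsubC //.
  by rewrite rootC.
rewrite [in RHS]def_q size_scale // size_prod_XsubC.
under eq_bigr do rewrite mupE.
have -> : (\sum_(x <- zs) count_mem x rs =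
           \sum_(x <- zs) \sum_(y <- rs) (y == x))%N.
  apply: eq_bigr => x _; rewrite -sum1_count [LHS]big_mkcond /=.
  by apply: eq_bigr => y _; case: eqP.
rewrite exchange_big /= -sum1_size; apply: eq_big_seq => y rs_y.
rewrite (bigD1_seq y) //=.
  by rewrite eqxx big1 // => x; rewrite eq_sym => /negbTE->.
by rewrite zsE def_q rootZ // root_prod_XsubC.
Qed.

End SplitPolynomials.

(** * Gram matrices and matrix polynomial forms *)

Section GramMatrices.
Variable R : realFieldType.

Lemma mulmx_tr_ge0 m (u : 'cV[R]_m) : 0 <= (u^T *m u) 0 0.
Proof. by rewrite mxE sumr_ge0 // => i _; rewrite mxE -expr2 sqr_ge0. Qed.

Lemma mulmx_tr_eq0 m (u : 'cV[R]_m) : (u^T *m u) 0 0 = 0 -> u = 0.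
Proof.
rewrite mxE => /eqP; rewrite psumr_eq0; last first.
  by move=> i _; rewrite mxE -expr2 sqr_ge0.
move=> /allP u0; apply/colP => i; rewrite mxE.
by have := u0 i (mem_index_enum _); rewrite /= mxE mulf_eq0 orbb => /eqP.
Qed.

(** For G the sum, v^T G v is the sum of the squared norms of the [U r *m v], so a null vector of G
    is killed by every [U r]. *)
Lemma gram_unitmx n k m (U : 'I_n -> 'M[R]_(k, m)) :
    (forall v : 'cV_m, (forall r, U r *m v = 0) -> v = 0) ->
  \sum_r (U r)^T *m U r \in unitmx.
Proof.
move=> U_inj; rewrite unitmxE unitfE; apply/negP => /det0P[v v0 vG].
case/eqP: v0; apply: trmx_inj; rewrite trmx0; apply: U_inj => r.
have: \sum_r ((U r *m v^T)^T *m (U r *m v^T)) 0 0 = 0.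
  rewrite -summxE.
  under eq_bigr do rewrite trmx_mul trmxK mulmxA -[v *m _ *m _]mulmxA.
  by rewrite -mulmx_suml -mulmx_sumr vG mul0mx mxE.
move=> /eqP; rewrite psumr_eq0 => [/allP/(_ r (mem_index_enum _))/=/eqP|].
  exact: mulmx_tr_eq0.
by move=> ? _; apply: mulmx_tr_ge0.
Qed.

(* [E] is an n x n array of p x p blocks. The complement [N] of [E] is a
   symmetric idempotent of trace 0, so its Frobenius norm vanishes. *)
Lemma block_idempotent_id n p (E : 'I_n -> 'I_n -> 'M[R]_p) :
    (forall r s, (E r s)^T = E s r) ->
    (forall r t, \sum_s E r s *m E s t = E r t) ->
    \sum_r \tr (E r r) = (n * p)%:R ->
  forall r s, E r s = (r == s)%:R%:M.
Proof.
move=> E_sym E_idem E_tr.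
pose N r s := (r == s)%:R%:M - E r s.
have N_sym r s : (N r s)^T = N s r.
  by rewrite linearB /= tr_scalar_mx E_sym eq_sym.
have delta_suml (f : 'I_n -> 'M[R]_p) r : \sum_s (r == s)%:R%:M *m f s = f r.
  rewrite (bigD1 r) //= eqxx mul1mx big1 ?addr0 // => s.
  by rewrite eq_sym => /negbTE->; rewrite raddf0 mul0mx.
have delta_sumr (f : 'I_n -> 'M[R]_p) t : \sum_s f s *m (s == t)%:R%:M = f t.
  rewrite (bigD1 t) //= eqxx mulmx1 big1 ?addr0 // => s /negbTE->.
  by rewrite raddf0 mulmx0.
have N_idem r t : \sum_s N r s *m N s t = N r t.
  under eq_bigr do rewrite mulmxBl mulmxBr [E r _ *m (_ - _)]mulmxBr.
  rewrite !sumrB E_idem (delta_sumr (E r)) subrr subr0.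
  by rewrite (delta_suml (fun s => (s == t)%:R%:M)) (delta_suml (fun s => E s t)).
have N_tr : \sum_r \tr (N r r) = 0.
  under eq_bigr do rewrite linearB /= eqxx mxtrace1.
  by rewrite sumrB E_tr sumr_const card_ord -mulrnA mulnC subrr.
have sqN r s : \tr (N r s *m N s r) = \sum_i \sum_j N r s i j ^+ 2.
  rewrite /mxtrace; apply: eq_bigr => i _; rewrite mxE; apply: eq_bigr => j _.
  by rewrite -N_sym mxE expr2.
have sqN_ge0 r s : 0 <= \tr (N r s *m N s r).
  by rewrite sqN; do 2 (apply: sumr_ge0 => ? _); apply: sqr_ge0.
move=> r s; apply/eqP; rewrite eq_sym -subr_eq0; apply/eqP.
rewrite -/(N r s); apply/matrixP => i j; rewrite [RHS]mxE.
have: \sum_r \sum_s \tr (N r s *m N s r) = 0.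
  by under eq_bigr do rewrite -linear_sum N_idem.
move=> /eqP; rewrite psumr_eq0 => [/allP/(_ r (mem_index_enum _))/=|]; last first.
  by move=> ? _; apply: sumr_ge0.
rewrite psumr_eq0 => [/allP/(_ s (mem_index_enum _))/=|] //.
rewrite sqN psumr_eq0 => [/allP/(_ i (mem_index_enum _))/=|]; last first.
  by move=> ? _; apply: sumr_ge0 => ? _; apply: sqr_ge0.
rewrite psumr_eq0 => [/allP/(_ j (mem_index_enum _))/=|]; last first.
  by move=> ? _; apply: sqr_ge0.
by rewrite sqrf_eq0 => /eqP.
Qed.

End GramMatrices.

(** The quadratic form is tested on e_i + c e_j with c = 1 and c = -1. *)
Lemma psdmx_coef_le (R : realType) p (A : 'M[R]_p) i j :
  A^T = A -> psdmx A -> `|A i j| <= (A i i + A j j) / 2.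
Proof.
move=> A_tr A_psd; have Aij : A j i = A i j by rewrite -[in LHS]A_tr mxE.
have A_quad c : 0 <= A i i + c * A i j *+ 2 + c ^+ 2 * A j j.
  have := A_psd (delta_mx i 0 + c *: delta_mx j 0).
  rewrite [(_ + _)^T]linearD /= [(_ *: _)^T]linearZ /= !trmx_delta
    !mulmxDl !mulmxDr -!scalemxAl -!scalemxAr.
  rewrite -!rowE -!colE !mxE Aij => /le_trans; apply.
  rewrite le_eqVlt; apply/orP; left; apply/eqP; ring.
have := A_quad 1; have := A_quad (-1); rewrite sqrrN expr1n !mul1r mulN1r.
by rewrite mulr2n; case: (ger0P (A i j)) => _; lra.
Qed.

(** * The bilinear form of an array of linear functionals *)

Section PolynomialForm.
Variables (R : comNzRingType) (p : nat).
Variable L : 'I_p -> 'I_p -> {scalar {poly R}}.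

(** With L_ij(q) = int q W_ij this is int A W B^T. Rectangular arguments allow single rows of
    polynomials, for which the form is a scalar. *)
Definition mxp_form m k (A : 'M[{poly R}]_(m, p)) (B : 'M[{poly R}]_(k, p)) :
  'M[R]_(m, k) := \matrix_(r, s) \sum_i \sum_j L i j (A r i * B s j).

Lemma mxp_form_sumr m k n (A : 'M[{poly R}]_(m, p))
    (B : 'I_n -> 'M[{poly R}]_(k, p)) :
  mxp_form A (\sum_s B s) = \sum_s mxp_form A (B s).
Proof.
apply/matrixP => r t; rewrite summxE mxE.
under [RHS]eq_bigr do rewrite mxE.
rewrite [RHS]exchange_big; apply: eq_bigr => i _.
rewrite [RHS]exchange_big; apply: eq_bigr => j _.
by rewrite summxE mulr_sumr linear_sum.
Qed.

Lemma mxp_form_mulr m k l (A : 'M[{poly R}]_(m, p)) (C : 'M[R]_(l, k))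
    (B : 'M[{poly R}]_(k, p)) :
  mxp_form A (map_mx polyC C *m B) = mxp_form A B *m C^T.
Proof.
apply/matrixP => r t; rewrite !mxE.
under [RHS]eq_bigr do rewrite !mxE mulr_suml.
rewrite [RHS]exchange_big; apply: eq_bigr => i _.
under [RHS]eq_bigr do rewrite mulr_suml.
rewrite [RHS]exchange_big; apply: eq_bigr => j _.
rewrite mxE mulr_sumr linear_sum; apply: eq_bigr => s _.
by rewrite mxE mul_polyC -scalerAr linearZ /= mulrC.
Qed.

(** The form sees only products of an entry of A with an entry of B, so a scalar factor may change
    sides. This is the source of the symmetry of multiplication by X. *)
Lemma mxp_form_shift m k (A : 'M[{poly R}]_(m, p)) (B : 'M[{poly R}]_(k, p)) :
  mxp_form ('X *: A) B = mxp_form A ('X *: B).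
Proof.
apply/matrixP => r t; rewrite !mxE; apply: eq_bigr => i _; apply: eq_bigr => j _.
by rewrite !mxE mulrCA mulrA.
Qed.

Lemma mxp_formBl m k (A A' : 'M[{poly R}]_(m, p)) (B : 'M[{poly R}]_(k, p)) :
  mxp_form (A - A') B = mxp_form A B - mxp_form A' B.
Proof.
apply/matrixP => r t; rewrite !mxE -sumrB; apply: eq_bigr => i _.
by rewrite -sumrB; apply: eq_bigr => j _; rewrite !mxE mulrBl linearB.
Qed.

Lemma mxp_formZl m k c (A : 'M[{poly R}]_(m, p)) (B : 'M[{poly R}]_(k, p)) :
  mxp_form (c%:P *: A) B = c *: mxp_form A B.
Proof.
apply/matrixP => r t; rewrite !mxE mulr_sumr; apply: eq_bigr => i _.
rewrite mulr_sumr; apply: eq_bigr => j _.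
by rewrite mxE -mulrA mul_polyC linearZ.
Qed.

Hypothesis L_sym : forall i j, L i j =1 L j i.

Lemma mxp_form_tr m k (A : 'M[{poly R}]_(m, p)) (B : 'M[{poly R}]_(k, p)) :
  (mxp_form A B)^T = mxp_form B A.
Proof.
apply/matrixP => r t; rewrite !mxE exchange_big; apply: eq_bigr => i _.
by apply: eq_bigr => j _; rewrite L_sym mulrC.
Qed.

Lemma mxp_form_suml m k n (A : 'M[{poly R}]_(m, p))
    (B : 'I_n -> 'M[{poly R}]_(k, p)) :
  mxp_form (\sum_s B s) A = \sum_s mxp_form (B s) A.
Proof.
rewrite -mxp_form_tr mxp_form_sumr linear_sum; apply: eq_bigr => s _.
exact: mxp_form_tr.
Qed.

Lemma mxp_form_mull m k l (A : 'M[{poly R}]_(m, p)) (C : 'M[R]_(l, k))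
    (B : 'M[{poly R}]_(k, p)) :
  mxp_form (map_mx polyC C *m B) A = C *m mxp_form B A.
Proof. by rewrite -mxp_form_tr mxp_form_mulr trmx_mul trmxK mxp_form_tr. Qed.

End PolynomialForm.

(** * Orthonormal matrix polynomials *)

Section OrthonormalPolynomials.
Variables (R : realType) (p : nat).
Variable L : 'I_p -> 'I_p -> {scalar {poly R}}.
Hypothesis L_sym : forall i j, L i j =1 L j i.
Variable P : nat -> 'M[{poly R}]_p.
Hypothesis P_size : forall n i j, (size (P n i j) <= n.+1)%N.
Hypothesis P_lead : forall n, map_mx (fun q : {poly R} => q`_n) (P n) \in unitmx.
Hypothesis P_orth :
  forall n m, mxp_form L (P n) (P m) = (n == m)%:R%:M.

Local Notation cmx := (map_mx polyC).
Local Notation form := (mxp_form L).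

Lemma orthonormal_span m n (A : 'M[{poly R}]_(m, p)) :
    (forall i j, (size (A i j) <= n)%N) ->
  exists C : nat -> 'M[R]_(m, p), A = \sum_(s < n) cmx (C s) *m P s.
Proof.
elim: n A => [|n IHn] A sA.
  exists (fun=> 0); rewrite big_ord0; apply/matrixP => i j; rewrite mxE.
  by apply/eqP; rewrite -size_poly_leq0.
(* Dividing by the invertible leading coefficient of [P n] makes [D] P_n cancel the terms of degree
   n in [A]. *)
pose D := map_mx (fun q : {poly R} => q`_n) A *m
  invmx (map_mx (fun q : {poly R} => q`_n) (P n)).
have [|C defC] := IHn (A - cmx D *m P n).
  move=> i j; apply/leq_sizeP => k le_nk; rewrite !mxE coefB coef_sum.
  under eq_bigr do rewrite mxE coefCM.
  have [<-|ne_nk] := eqVneq n k; last first.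
    have lt_nk : (n < k)%N by rewrite ltn_neqAle ne_nk.
    rewrite nth_default ?(leq_trans (sA _ _)) // big1 ?subrr // => l _.
    by rewrite nth_default ?mulr0 // (leq_trans (P_size _ _ _)).
  have /matrixP/(_ i j) : D *m map_mx (fun q : {poly R} => q`_n) (P n) =
      map_mx (fun q : {poly R} => q`_n) A by rewrite mulmxKV.
  rewrite !mxE => <-; apply/eqP; rewrite subr_eq0; apply/eqP.
  by apply: eq_bigr => l _; congr (_ * _); rewrite mxE.
exists (fun s => if s == n then D else C s).
rewrite big_ord_recr /= eqxx -[LHS](subrK (cmx D *m P n)) defC; congr (_ + _).
by apply: eq_bigr => s _; rewrite ltn_eqF.
Qed.

Lemma orthonormal_expansion m n (A : 'M[{poly R}]_(m, p)) :
    (forall i j, (size (A i j) <= n)%N) ->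
  A = \sum_(s < n) cmx (form A (P s)) *m P s.
Proof.
move=> /orthonormal_span[C defA]; rewrite [LHS]defA.
apply: eq_bigr => s _; congr (cmx _ *m _).
rewrite defA mxp_form_suml // (bigD1 s) //= mxp_form_mull // P_orth eqxx mulmx1.
rewrite big1 ?addr0 // => r /negbTE ne_rs.
by rewrite mxp_form_mull // P_orth [_ == _ :> nat]ne_rs raddf0 mulmx0.
Qed.

(** Parseval's identity: orthonormality leaves only the diagonal terms. *)
Lemma mxp_form_expansion m k n (C : 'I_n -> 'M[R]_(m, p))
    (D : 'I_n -> 'M[R]_(k, p)) :
  form (\sum_s cmx (C s) *m P s) (\sum_s cmx (D s) *m P s) =
  \sum_s C s *m (D s)^T.
Proof.
rewrite mxp_form_suml //; apply: eq_bigr => s _.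
rewrite mxp_form_mull // mxp_form_sumr; congr (_ *m _).
rewrite (bigD1 s) //= mxp_form_mulr // P_orth eqxx mul1mx.
rewrite big1 ?addr0 // => r; rewrite eq_sym => /negbTE ne_rs.
by rewrite mxp_form_mulr // P_orth [_ == _ :> nat]ne_rs raddf0 mul0mx.
Qed.

(** The blocks of multiplication by X in the orthonormal basis. *)
Let a r s : 'M[R]_p := form ('X *: P r) (P s).

Let a_tr r s : (a r s)^T = a s r.
Proof. by rewrite /a mxp_form_tr // mxp_form_shift. Qed.

(** X P_r has degree at most r + 1 <= n, so P_0, ..., P_n suffice to expand it. *)
Lemma orthonormal_recurrence n r : (r < n)%N ->
  'X *: P r = \sum_(s < n.+1) cmx (a r s) *m P s.
Proof.
move=> lt_rn; apply: orthonormal_expansion => i j; rewrite mxE.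
by rewrite mulrC (leq_trans (size_polyMleq _ _)) // size_polyX addn2 /=
  !(leq_ltn_trans (P_size _ _ _)).
Qed.

Section NullVectors.
Variables (K : comNzRingType) (n m : nat).
Variables (f : {rmorphism {poly R} -> K}) (v : 'M[K]_(p, m)).
Hypothesis Pn_v : map_mx f (P n) *m v = 0.

(** The term s = n of the recurrence vanishes on [v]. What remains says that the blocks P_r v, r <
    n, form an eigenvector of the truncated block matrix [a]. *)
Lemma null_vector_recurrence r : (r < n)%N ->
  f 'X *: (map_mx f (P r) *m v) =
  \sum_(s < n) map_mx f (cmx (a r s)) *m (map_mx f (P s) *m v).
Proof.
move=> /orthonormal_recurrence/(congr1 (map_mx f)).
have -> : map_mx f ('X *: P r) = f 'X *: map_mx f (P r).
  by apply/matrixP => i j; rewrite !mxE rmorphM.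
rewrite raddf_sum /= => /(congr1 (mulmx^~ v)); rewrite -scalemxAl => ->.
rewrite mulmx_suml big_ord_recr /= map_mxM -[_ *m _ *m v]mulmxA Pn_v mulmx0 addr0.
by apply: eq_bigr => s _; rewrite map_mxM mulmxA.
Qed.

End NullVectors.

(* Christoffel-Darboux at two points where [P n] has null vectors. The
   morphisms [f] and [g] are evaluations, at real or complex points. *)
Lemma null_vector_orthogonal (K : comNzRingType) n m m'
    (f g : {rmorphism {poly R} -> K}) (v : 'M[K]_(p, m)) (w : 'M[K]_(p, m')) :
    (forall c : R, f c%:P = g c%:P) ->
    map_mx f (P n) *m v = 0 -> map_mx g (P n) *m w = 0 ->
  (f 'X - g 'X) *:
    \sum_(r < n) (map_mx f (P r) *m v)^T *m (map_mx g (P r) *m w) = 0.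
Proof.
move=> fg Pv Pw; rewrite scalerBl; apply/eqP; rewrite subr_eq0; apply/eqP.
rewrite !scaler_sumr.
under eq_bigr => r _ do
  rewrite scalemxAl -linearZ (null_vector_recurrence Pv) // linear_sum mulmx_suml.
under [RHS]eq_bigr => r _ do
  rewrite scalemxAr (null_vector_recurrence Pw) // mulmx_sumr.
rewrite exchange_big; apply: eq_bigr => r _; apply: eq_bigr => s _ /=.
rewrite trmx_mul -mulmxA; congr (_ *m (_ *m _)).
(* After the exchange of sums both sides agree up to transposing a block of the symmetric matrix
   [a]. *)
rewrite -(a_tr s r).
by apply/matrixP => i j; rewrite !mxE fg.
Qed.

Lemma P0_const : P 0 = cmx (map_mx (fun q : {poly R} => q`_0) (P 0)).
Proof.
by apply/matrixP => i j; rewrite !mxE; apply: size1_polyC; exact: P_size.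
Qed.

(** P_0 is a constant invertible matrix. Hence the block r = 0 alone shows that a nonzero null
    vector yields a nonzero eigenvector. *)
Lemma P0_inj (K : fieldType) (f : {rmorphism {poly R} -> K}) m (v : 'M[K]_(p, m)) :
  map_mx f (P 0) *m v = 0 -> v = 0.
Proof.
rewrite P0_const -map_mx_comp /=.
set h := (X in map_mx X).
have -> : map_mx h (map_mx (fun q : {poly R} => q`_0) (P 0)) =
          map_mx (f \o polyC) (map_mx (fun q : {poly R} => q`_0) (P 0)) by [].
set U := map_mx _ _ => Uv.
have U_unit : U \in unitmx by rewrite /U map_unitmx P_lead.
by rewrite -[v](mulKmx U_unit) Uv mulmx0.
Qed.

(** The upper bound comes from the Leibniz terms; the coefficient of degree np is the determinant of
    the invertible leading coefficient. *)
Lemma size_det n : size (\det (P n)) = (n * p).+1.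
Proof.
apply/eqP; rewrite eqn_leq; apply/andP; split.
  apply: (leq_trans (size_sum _ _ _)); apply/bigmax_leqP => /= s _.
  rewrite -(rmorph1 polyC) -rmorphN -rmorphXn mul_polyC.
  apply: leq_trans (size_scale_leq _ _) _.
  have [_] := coef_prod_top (enum 'I_p) (fun i => P_size n i ((s : {perm _}) i)).
  by rewrite size_enum_ord big_enum mulnC.
rewrite ltnNge; apply/negP => /leq_sizeP/(_ (p * n)%N).
rewrite mulnC leqnn => /(_ isT); rewrite coef_det_top; last exact: P_size.
by apply/eqP; rewrite -unitfE -unitmxE P_lead.
Qed.

Lemma det_neq0 n : \det (P n) != 0.
Proof. by rewrite -size_poly_eq0 size_det. Qed.

(** Christoffel-Darboux for a null vector v at z and its conjugate at conj z gives (z - conj z)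
    sum_r |P_r(z) v|^2 = 0. The sum is nonzero because of its term r = 0. *)
Lemma complex_root_real n (z : R[i]) : (0 < n)%N ->
  root (map_poly (real_complex R) (\det (P n))) z -> complex.Im z = 0.
Proof.
move=> n_gt0.
pose f : {rmorphism {poly R} -> R[i]} := horner_eval z \o map_poly (real_complex R).
pose g : {rmorphism {poly R} -> R[i]} :=
  horner_eval (conjc z) \o map_poly (real_complex R).
(* The coefficients are real, so evaluating at conj z conjugates the value at z. *)
have fgJ q : g q = conjc (f q).
  rewrite /g /f /= !horner_evalE -horner_map -map_poly_comp; congr _.[_].
  by apply: eq_map_poly => x /=; apply/esym/conjc_real.
rewrite rootE -[_.[z]]/(f (\det (P n))) -det_map_mx -det_tr.
move=> /det0P[u u0 uP]; pose v := u^T.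
have Pv : map_mx f (P n) *m v = 0.
  by apply: trmx_inj; rewrite trmx_mul trmxK trmx0.
have PgJ r : map_mx g (P r) *m map_mx (@conjc R) v =
             map_mx (@conjc R) (map_mx f (P r) *m v).
  by rewrite map_mxM; congr (_ *m _); apply/matrixP => i j; rewrite !mxE fgJ.
have Pw : map_mx g (P n) *m map_mx (@conjc R) v = 0.
  by rewrite PgJ Pv map_mx0.
have fg c : f c%:P = g c%:P.
  by rewrite fgJ /f /= horner_evalE map_polyC hornerC; apply/esym/conjc_real.
have /matrixP/(_ 0 0) := null_vector_orthogonal fg Pv Pw.
rewrite !mxE => /eqP; rewrite mulf_eq0 => /orP[|].
  rewrite fgJ /f /= horner_evalE map_polyX hornerX subr_eq0.
  by case: z {f g fgJ uP Pv PgJ Pw fg} => x y /= /eqP[] yN; lra.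
rewrite summxE psumr_eq0 => [|r _]; last first.
  rewrite mxE PgJ; apply: sumr_ge0 => i _.
  by rewrite [X in X * _]mxE [X in _ * X]mxE; apply: mulcJ_ge0.
move=> /allP/(_ (Ordinal n_gt0) (mem_index_enum _)); rewrite /= mxE PgJ.
rewrite psumr_eq0 => [/allP vJ|i _]; last first.
  by rewrite [X in X * _]mxE [X in _ * X]mxE; apply: mulcJ_ge0.
suff v0 : v = 0 by rewrite -[u]trmxK -/v v0 trmx0 eqxx in u0.
apply: (@P0_inj _ f); apply/colP => i; rewrite [RHS]mxE; apply/eqP.
have := vJ i (mem_index_enum _); rewrite /= [X in X * _]mxE [X in _ * X]mxE.
by rewrite mulf_eq0 conjc_eq0 orbb.
Qed.

Lemma sum_zero_mult n (zs : seq R) : (0 < n)%N ->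
    uniq zs -> (forall x, (x \in zs) = root (\det (P n)) x) ->
  (\sum_(x <- zs) mup x (\det (P n)) = n * p)%N.
Proof.
move=> n_gt0 zs_uniq zsE.
have [rs def_det] :=
  real_rooted_splits (det_neq0 n) (fun z => complex_root_real n_gt0).
by rewrite (sum_mup_splits (det_neq0 n) def_det) // size_det.
Qed.

(** As a polynomial in t, [q] is v^T K_{n-1}(t, x). The eigenvector equation makes x its Rayleigh
    quotient for multiplication by X. *)
Lemma real_null_vector_form n x (v : 'cV[R]_p) :
    map_mx (horner_eval x) (P n) *m v = 0 ->
  let q := \sum_(r < n) cmx (map_mx (horner_eval x) (P r) *m v)^T *m P r in
  form ('X *: q) q = x *: form q q.
Proof.
move=> Pv /=; set u := fun r => map_mx (horner_eval x) (P r) *m v.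
have evC m k (C : 'M[R]_(m, k)) : map_mx (horner_eval x) (cmx C) = C.
  by apply/matrixP => i j; rewrite !mxE horner_evalE hornerC.
rewrite (mxp_form_expansion (fun r => (u r)^T) (fun r => (u r)^T)).
rewrite 2!scaler_sumr mxp_form_suml //; apply: eq_bigr => r _.
rewrite scalemxAr mxp_form_mull // mxp_form_sumr trmxK scalemxAr; congr (_ *m _).
have := null_vector_recurrence Pv (ltn_ord r).
rewrite /= [horner_eval x 'X]horner_evalE hornerX => ->; apply: eq_bigr => s _.
by rewrite mxp_form_mulr // trmxK; congr (_ *m _); apply/esym/evC.
Qed.

Lemma zero_in_itv n (a0 b0 x : R) : (0 < n)%N ->
    (forall q : 'rV[{poly R}]_p, a0 * form q q 0 0 <= form ('X *: q) q 0 0) ->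
    (forall q : 'rV[{poly R}]_p, form ('X *: q) q 0 0 <= b0 * form q q 0 0) ->
    root (\det (P n)) x -> a0 <= x <= b0.
Proof.
move=> n_gt0 geq leq.
rewrite rootE -[_.[x]]/(horner_eval x (\det (P n))) -det_map_mx -det_tr.
move=> /det0P[u u0 uP]; pose v := u^T.
have Pv : map_mx (horner_eval x) (P n) *m v = 0.
  by apply: trmx_inj; rewrite trmx_mul trmxK trmx0.
have := real_null_vector_form Pv; set q := \sum_(r < n) _ => /= Xq.
(* The form at [q] is sum_r |P_r(x) v|^2, whose term r = 0 is nonzero. *)
have q_gt0 : 0 < form q q 0 0.
  rewrite /q mxp_form_expansion summxE lt_neqAle eq_sym sumr_ge0 ?andbT; last first.
    by move=> r _; rewrite trmxK mulmx_tr_ge0.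
  apply/negP; rewrite psumr_eq0 => [|r _]; last by rewrite trmxK mulmx_tr_ge0.
  move=> /allP/(_ (Ordinal n_gt0) (mem_index_enum _))/= /eqP.
  rewrite trmxK => /mulmx_tr_eq0/P0_inj v0.
  by rewrite -[u]trmxK -/v v0 trmx0 eqxx in u0.
have := geq q; have := leq q; rewrite Xq mxE.
by rewrite !ler_pM2r // => -> ->.
Qed.

(** * Exactness of the Gaussian quadrature *)

(** [kernel_mx P n] includes the index n, so it is the kernel K_n that belongs to the zeros of
    [P n.+1]. *)
Lemma kernel_mx_gram n x m (V : 'M[R]_(p, m)) :
  V^T *m kernel_mx P n x x *m V =
  \sum_(r < n.+1) (mxpeval (P r) x *m V)^T *m (mxpeval (P r) x *m V).
Proof.
rewrite /kernel_mx mulmx_sumr mulmx_suml; apply: eq_bigr => r _.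
by rewrite trmx_mul !mulmxA.
Qed.

Lemma gauss_gram_tr n x m (V : 'M[R]_(p, m)) :
  (V^T *m kernel_mx P n x x *m V)^T = V^T *m kernel_mx P n x x *m V.
Proof.
rewrite kernel_mx_gram linear_sum; apply: eq_bigr => r _.
by rewrite /= trmx_mul trmxK.
Qed.

(** If all P_r(x) V v vanish, the block r = 0 gives V v = 0, and V has full column rank. *)
Lemma gauss_gram_unitmx n x m (V : 'M[R]_(p, m)) :
  row_free V^T -> V^T *m kernel_mx P n x x *m V \in unitmx.
Proof.
move=> V_free; rewrite kernel_mx_gram; apply: gram_unitmx => v /(_ ord0).
rewrite -mulmxA => /(@P0_inj _ (horner_eval x)) Vv0.
apply: trmx_inj; apply: (row_free_inj V_free).
by rewrite -trmx_mul Vv0 !trmx0 mul0mx.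
Qed.

Lemma gauss_coef_tr n x m (V : 'M[R]_(p, m)) :
  (gauss_coef P n x V)^T = gauss_coef P n x V.
Proof. by rewrite /gauss_coef !trmx_mul trmxK trmx_inv gauss_gram_tr mulmxA. Qed.

(** With G the Gram matrix and u = G^-1 V^T v, the value at v is u^T G u, a sum of squares. *)
Lemma gauss_coef_unit_psd n x m (V : 'M[R]_(p, m)) :
  V^T *m kernel_mx P n x x *m V \in unitmx -> psdmx (gauss_coef P n.+1 x V).
Proof.
move=> G_unit v; rewrite /gauss_coef /=.
have := gauss_gram_tr n x V; have := kernel_mx_gram n x V.
move: (_ *m V) G_unit => G G_unit G_gram G_tr.
have -> : v^T *m (V *m invmx G *m V^T) *m v =
    (invmx G *m (V^T *m v))^T *m G *m (invmx G *m (V^T *m v)).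
  rewrite -[_ *m G *m _]mulmxA mulKVmx // !trmx_mul trmxK trmx_inv G_tr.
  by rewrite !mulmxA.
move: (invmx G *m _) => u; rewrite G_gram mulmx_sumr mulmx_suml summxE.
apply: sumr_ge0 => r _.
by move: (_ *m V) => U; rewrite mulmxA -mulmxA -trmx_mul mulmx_tr_ge0.
Qed.

Lemma gauss_coef_mulK n x m (V : 'M[R]_(p, m)) :
    V^T *m kernel_mx P n x x *m V \in unitmx ->
  gauss_coef P n.+1 x V *m kernel_mx P n x x *m gauss_coef P n.+1 x V =
  gauss_coef P n.+1 x V.
Proof.
move=> G_unit; rewrite /gauss_coef /=; move: (kernel_mx _ _ _ _) G_unit => K.
move=> G_unit; rewrite !mulmxA -[_ *m V^T *m K]mulmxA -[_ *m _ *m V]mulmxA.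
by rewrite mulmxKV.
Qed.

Lemma gauss_coef_mul0 n x y m m' (V : 'M[R]_(p, m)) (W : 'M[R]_(p, m')) :
    V^T *m kernel_mx P n y x *m W = 0 ->
  gauss_coef P n.+1 x V *m kernel_mx P n y x *m gauss_coef P n.+1 y W = 0.
Proof.
move=> VKW; rewrite /gauss_coef !mulmxA -[_ *m V^T *m _]mulmxA.
by rewrite -[_ *m _ *m W]mulmxA VKW mulmx0 !mul0mx.
Qed.

Lemma gauss_coef_mxtrace n x m (V : 'M[R]_(p, m)) :
    V^T *m kernel_mx P n x x *m V \in unitmx ->
  \tr (kernel_mx P n x x *m gauss_coef P n.+1 x V) = m%:R.
Proof.
move=> G_unit; rewrite /gauss_coef /= mulmxA mxtrace_mulC !mulmxA mulmxV //.
exact: mxtrace1.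
Qed.

(** Contracts the middle index in the product of two blocks of the quadrature array. *)
Lemma mulmx_kernel n x y (A M N B : 'M[R]_p) :
  \sum_(s < n.+1) (A *m M *m (mxpeval (P s) x)^T) *m (mxpeval (P s) y *m N *m B) =
  A *m (M *m kernel_mx P n y x *m N) *m B.
Proof.
rewrite /kernel_mx mulmx_sumr !mulmx_suml mulmx_sumr mulmx_suml.
by apply: eq_bigr => s _; rewrite !mulmxA.
Qed.

Lemma kernel_mx_null_vectors n x y m m' (V : 'M[R]_(p, m)) (W : 'M[R]_(p, m')) :
    x != y -> mxpeval (P n.+1) x *m V = 0 -> mxpeval (P n.+1) y *m W = 0 ->
  V^T *m kernel_mx P n y x *m W = 0.
Proof.
move=> ne_xy Px Py.
have fg c : horner_eval x c%:P = horner_eval y c%:P.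
  by rewrite !horner_evalE !hornerC.
have /eqP := null_vector_orthogonal fg Px Py.
rewrite /= !horner_evalE !hornerX scaler_eq0 subr_eq0 (negPf ne_xy) /= => /eqP <-.
rewrite /kernel_mx mulmx_sumr mulmx_suml; apply: eq_bigr => r _.
by rewrite trmx_mul !mulmxA.
Qed.

Section Quadrature.
Variables (n : nat) (zs : seq R).
Hypothesis zs_uniq : uniq zs.
Hypothesis zsE : forall x, (x \in zs) = root (\det (P n.+1)) x.
Variable V : forall x : R, 'M[R]_(p, zero_mult P n.+1 x).
Hypothesis V_null : forall x, x \in zs -> zero_vectors (V x).

Local Notation Lam x := (gauss_coef P n.+1 x (V x)).

Let gauss_unit x : x \in zs ->
  (V x)^T *m kernel_mx P n x x *m V x \in unitmx.
Proof.
move=> /V_null[_ rV]; apply: gauss_gram_unitmx.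
by rewrite /row_free mxrank_tr rV.
Qed.

Lemma gauss_coef_psd x : x \in zs -> psdmx (Lam x).
Proof. by move=> zs_x; apply: gauss_coef_unit_psd; apply: gauss_unit. Qed.

Let Lam_kernel x y : x \in zs -> y \in zs ->
  Lam x *m kernel_mx P n y x *m Lam y = if x == y then Lam x else 0.
Proof.
move=> zs_x zs_y; have [<-|ne_xy] := eqVneq x y.
  by apply: gauss_coef_mulK; apply: gauss_unit.
apply: gauss_coef_mul0; apply: kernel_mx_null_vectors ne_xy _ _.
  by have [] := V_null zs_x.
by have [] := V_null zs_y.
Qed.

Let E (r s : 'I_n.+1) :=
  \sum_(x <- zs) mxpeval (P r) x *m Lam x *m (mxpeval (P s) x)^T.

Lemma gauss_orthonormal r s : E r s = (r == s)%:R%:M.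
Proof.
apply: (@block_idempotent_id _ n.+1 p E).
- move=> {}r {}s; rewrite /E linear_sum; apply: eq_bigr => x _.
  by rewrite /= 2!trmx_mul trmxK gauss_coef_tr mulmxA.
(* Idempotence: summing over the middle index leaves Lambda_x K_n Lambda_y, which is Lambda_x for x
   = y and 0 otherwise. *)
- move=> {}r t; rewrite /E.
  under eq_bigr do rewrite mulmx_suml.
  rewrite exchange_big /=; apply: eq_big_seq => x zs_x.
  under eq_bigr do rewrite mulmx_sumr.
  rewrite exchange_big /= (eq_big_seq (fun y => if x == y then
     mxpeval (P r) x *m Lam x *m (mxpeval (P t) x)^T else 0)).
    rewrite (bigD1_seq x) //= eqxx big1 ?addr0 // => y.
    by rewrite eq_sym => /negPf->.
  move=> y zs_y.
  rewrite mulmx_kernel Lam_kernel //; case: eqP => [->//|_].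
  by rewrite mulmx0 mul0mx.
(* Trace: by cyclicity each zero contributes tr(K_n Lambda_x), its multiplicity, and the
   multiplicities add up to (n + 1) p. *)
rewrite /E; under eq_bigr do rewrite linear_sum.
rewrite exchange_big /= -(sum_zero_mult (ltn0Sn n) zs_uniq zsE) natr_sum.
apply: eq_big_seq => x zs_x.
under eq_bigr do rewrite mxtrace_mulC mulmxA.
rewrite -linear_sum -mulmx_suml; apply: gauss_coef_mxtrace.
exact: gauss_unit.
Qed.

(** Expand q I = sum C_s P_s and I = sum D_s P_s. Parseval for the form and discrete orthonormality
    for the quadrature both give sum C_s D_s^T. *)
Lemma gauss_quadrature_exact (q : {poly R}) : (size q <= n.+1)%N ->
  \sum_(x <- zs) q.[x] *: Lam x = \matrix_(i, j) L i j q.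
Proof.
move=> sq.
have size_scalar (r : {poly R}) (i j : 'I_p) : (size r <= n.+1)%N ->
    (size ((r%:M : 'M[{poly R}]_p) i j) <= n.+1)%N.
  by move=> sr; rewrite mxE; case: (i == j); rewrite ?mulr0n ?size_poly0.
have [C defC] := orthonormal_span (fun i j => size_scalar q i j sq).
have s1 : (size (1%R : {poly R}) <= n.+1)%N by rewrite size_poly1.
have [D defD] := orthonormal_span (fun i j => size_scalar 1%R i j s1).
have -> : \matrix_(i, j) L i j q = form q%:M 1%:M.
  apply/matrixP => r s; rewrite !mxE (bigD1 r) //=.
  rewrite [X in _ + X]big1 ?addr0 => [|i ne_ir]; last first.
    by rewrite big1 // => j _; rewrite !mxE eq_sym (negPf ne_ir) mul0r linear0.
  rewrite (bigD1 s) //= big1 ?addr0 => [|j ne_js].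
    by rewrite !mxE !eqxx mulr1.
  by rewrite !mxE [s == j]eq_sym (negPf ne_js) mulr0 linear0.
rewrite defC defD.
rewrite (mxp_form_expansion (fun s : 'I_n.+1 => C s) (fun s : 'I_n.+1 => D s)).
have evD (B : nat -> 'M[R]_p) (r : {poly R}) x :
    r%:M = \sum_(s < n.+1) cmx (B s) *m P s ->
    (r.[x])%:M = \sum_(s < n.+1) B s *m mxpeval (P s) x.
  move=> /(congr1 (map_mx (horner_eval x))); rewrite map_scalar_mx raddf_sum => ->.
  apply: eq_bigr => s _; rewrite /= map_mxM; congr (_ *m _).
  by apply/matrixP => i j; rewrite !mxE; apply: hornerC.
transitivity (\sum_(s < n.+1) \sum_(t < n.+1) C s *m E s t *m (D t)^T).
  have -> : \sum_(x <- zs) q.[x] *: Lam x = \sum_(x <- zs) \sum_(s < n.+1)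
      \sum_(t < n.+1) C s *m
        (mxpeval (P s) x *m Lam x *m (mxpeval (P t) x)^T) *m (D t)^T.
    apply: eq_bigr => x _; move: (Lam x) => A.
    rewrite -mul_scalar_mx -[LHS]mulmx1 -[1%:M]trmx1 -[1](hornerC 1 x).
    rewrite (evD _ _ x defC) (evD _ _ x defD) !mulmx_suml; apply: eq_bigr => s _.
    rewrite linear_sum mulmx_sumr; apply: eq_bigr => t _.
    by rewrite /= trmx_mul !mulmxA.
  rewrite exchange_big; apply: eq_bigr => s _.
  rewrite exchange_big; apply: eq_bigr => t _.
  by rewrite /E mulmx_sumr mulmx_suml.
apply: eq_bigr => s _; rewrite (bigD1 s) //= gauss_orthonormal eqxx mulmx1.
rewrite big1 ?addr0 // => t; rewrite gauss_orthonormal eq_sym => /negPf->.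
by rewrite raddf0 mulmx0 mul0mx.
Qed.

(** Positivity bounds each entry by diagonal ones, and exactness at q = 1 sums the diagonal entries.
    The bound does not depend on n. *)
Lemma sum_gauss_coef_le i j :
  \sum_(x <- zs) `|Lam x i j| <= (L i i 1 + L j j 1) / 2.
Proof.
have sumLam k : \sum_(x <- zs) Lam x k k = L k k 1.
  have := @gauss_quadrature_exact 1; rewrite size_poly1 => /(_ isT).
  move=> /matrixP/(_ k k); rewrite mxE summxE => <-.
  by apply: eq_bigr => x _; rewrite hornerC scale1r.
rewrite -!sumLam -big_split /= mulr_suml big_seq [leRHS]big_seq.
apply: ler_sum => x zs_x.
exact: psdmx_coef_le (gauss_coef_tr _ _ _) (gauss_coef_psd zs_x).
Qed.

End Quadrature.
End OrthonormalPolynomials.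

(** * Weierstrass approximation *)

Section Weierstrass.
Variable R : realType.

(** A quadratic error term is what the variance in Bernstein's argument controls. Near points are
    handled by continuity, far ones by boundedness, and compactness makes K uniform. *)
Lemma continuous_quadratic_modulus (A : set R) (f : R -> R) (e : R) :
    compact A -> {within A, continuous f} -> 0 < e ->
  exists2 K, 0 <= K &
    forall x y, A x -> A y -> `|f x - f y| <= e + K * (x - y) ^+ 2.
Proof.
move=> A_compact f_cont e_gt0.
have [M [_ fM]] := compact_bounded (continuous_compact f_cont A_compact).
pose B := `|M| + 1; have f_le x : A x -> `|f x| <= B.
  by move=> Ax; apply: fM; [rewrite ltr_pwDr // ler_norm | exists x].
have B_ge0 : 0 <= B by rewrite addr_ge0.
have /near_covering_withinP A_cover := (compact_near_coveringP A).1 A_compact.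
have [K [_ fK]] : \forall K \near +oo, A `<=` (fun x => forall y, A y ->
    `|f x - f y| <= e + K * (x - y) ^+ 2).
  apply: A_cover => x Ax.
  have e2_gt0 : 0 < e / 2 by rewrite divr_gt0.
  have /cvgrPdist_lt/(_ _ e2_gt0)/nbhs_ballP[r /= r_gt0 fr] :=
    (@subspace_continuousP _ A _ f).1 f_cont x Ax.
  have r2_gt0 : 0 < r / 2 by rewrite divr_gt0.
  (* For |x' - y| >= r/2 such a K makes the quadratic term at least 2B, which bounds |f x' - f y|.
     Halving r keeps y within r of x when |x' - y| < r/2. *)
  exists (ball x (r / 2), [set K | 2 * B / (r / 2) ^+ 2 <= K]) => /=.
    by split; [exact: nbhsx_ballx | apply: nbhs_pinfty_ge; exact: num_real].
  move=> [x' K] /= [xx' K_ge] Ax' y Ay.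
  have K_ge0 : 0 <= K.
    by apply: le_trans K_ge; rewrite divr_ge0 ?sqr_ge0 ?mulr_ge0.
  have [near_y|far_y] := ltP `|x' - y| (r / 2).
    have fx' : `|f x - f x'| < e / 2.
      by apply: fr => //; apply: lt_trans xx' _; rewrite gtr_pMr // invf_lt1 // ltr1n.
    have fy : `|f x - f y| < e / 2.
      apply: fr => //=; rewrite /ball /= [r]splitr.
      rewrite -[x - y](subrKA x'); apply: le_lt_trans (ler_normD _ _) _.
      exact: ltrD.
    apply: (@le_trans _ _ e); last by rewrite lerDl mulr_ge0 ?sqr_ge0.
    rewrite -[f x' - f y](subrKA (f x)) [e]splitr.
    apply: le_trans (ler_normD _ _) _.
    by apply: lerD; [rewrite distrC|]; apply: ltW.
  apply: (@le_trans _ _ (2 * B)).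
    rewrite mulr2n mulrDl !mul1r; apply: le_trans (ler_normB _ _) _.
    by rewrite lerD // f_le.
  apply: (@le_trans _ _ (K * (x' - y) ^+ 2)); last by rewrite lerDr ltW.
  move: K_ge; rewrite ler_pdivrMr ?exprn_gt0 // => /le_trans; apply.
  by rewrite ler_wpM2l // -[leRHS]real_normK ?num_real // lerXn2r ?nnegrE // ltW.
exists (`|K| + 1) => [|x y Ax Ay]; first by rewrite addr_ge0.
by apply: (fK (`|K| + 1)) => //; rewrite ltr_pwDr // ler_norm.
Qed.

(* The Bernstein polynomial of a function whose value at [k / n] is [h k], built
   by de Casteljau's recursion so that no binomial sum is needed. *)
Fixpoint casteljau n (h : nat -> R) : {poly R} :=
  if n is m.+1 then
    (1 - 'X) * casteljau m h + 'X * casteljau m (fun k => h k.+1)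
  else (h 0)%:P.

(* [(n t - d) ^+ 2 + n t (1 - t)] is the second moment about [d] of the
   binomial distribution of parameters [n] and [t]. *)
Lemma casteljau_approx n h (c e K d t : R) : 0 <= t <= 1 ->
    (forall k, (k <= n)%N -> `|h k - c| <= e + K * (k%:R - d) ^+ 2) ->
  `|(casteljau n h).[t] - c| <=
    e + K * ((n%:R * t - d) ^+ 2 + n%:R * t * (1 - t)).
Proof.
move=> /andP[t_ge0 t_le1]; elim: n h d => [|n IHn] h d hK.
  by rewrite /= hornerC mul0r mul0r addr0; apply: hK.
have h0 : `|(casteljau n h).[t] - c| <=
    e + K * ((n%:R * t - d) ^+ 2 + n%:R * t * (1 - t)).
  by apply: IHn => k le_kn; apply: hK; rewrite (leq_trans le_kn).
(* Shifting the nodes by one amounts to moving the centre from d to d - 1. *)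
have h1 : `|(casteljau n (fun k => h k.+1)).[t] - c| <=
    e + K * ((n%:R * t - (d - 1)) ^+ 2 + n%:R * t * (1 - t)).
  apply: IHn => k le_kn; apply: le_trans (hK k.+1 le_kn) _.
  by rewrite -natr1 opprB addrA addrAC.
rewrite /= !hornerE; set u := (casteljau n h).[t] in h0 *.
set v := (casteljau n _).[t] in h1 *.
have -> : (1 - t) * u + t * v - c = (1 - t) * (u - c) + t * (v - c) by ring.
apply: le_trans (ler_normD _ _) _; have s_ge0 : 0 <= 1 - t by rewrite subr_ge0.
rewrite !normrM (ger0_norm t_ge0) (ger0_norm s_ge0).
apply: le_trans (lerD (ler_wpM2l s_ge0 h0) (ler_wpM2l t_ge0 h1)) _.
(* With M_n(d) the second moment, (1 - t) M_n(d) + t M_n(d - 1) = M_{n+1}(d). *)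
by rewrite le_eqVlt; apply/orP; left; apply/eqP; rewrite -natr1; ring.
Qed.

Theorem weierstrass (a b : R) (f : R -> R) (e : R) : a < b ->
    {within `[a, b], continuous f} -> 0 < e ->
  exists q : {poly R}, forall x, x \in `[a, b] -> `|f x - q.[x]| <= e.
Proof.
move=> ab f_cont e_gt0; have e2_gt0 : 0 < e / 2 by rewrite divr_gt0.
have [K K_ge0 fK] :=
  continuous_quadratic_modulus (@segment_compact _ a b) f_cont e2_gt0.
have ba_gt0 : 0 < b - a by rewrite subr_gt0.
pose C := K * (b - a) ^+ 2; have C_ge0 : 0 <= C by rewrite mulr_ge0 ?sqr_ge0.
have [n n_gt0 C_le] : exists2 n, 0 < n%:R :> R & C / n%:R <= e / 2.
  exists (Num.truncn (C / (e / 2))).+1; first by rewrite ltr0n.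
  rewrite ler_pdivrMr ?ltr0n // mulrC -ler_pdivrMr //.
  exact/ltW/truncnS_gt.
pose node k := a + (b - a) * (k%:R / n%:R).
(* The Bernstein polynomial on [0, 1], pulled back by the affine map from [a, b]. *)
exists (casteljau n (f \o node) \Po ((b - a)^-1 *: ('X - a%:P))) => x xab.
rewrite horner_comp !hornerE; set t := _ * (x - a).
have /andP[ax xb] : a <= x <= b by move: xab; rewrite in_itv.
have t01 : 0 <= t <= 1.
  rewrite /t mulrC divr_ge0 ?subr_ge0 ?(ltW ab) //=.
  by rewrite ler_pdivrMr // mul1r lerB.
have xE : x = a + (b - a) * t by rewrite /t; field; rewrite gt_eqF.
rewrite distrC.
have node_le k : (k <= n)%N ->
    `|(f \o node) k - f x| <= e / 2 + (C / n%:R ^+ 2) * (k%:R - n%:R * t) ^+ 2.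
  move=> le_kn; have kn1 : k%:R / n%:R <= 1 :> R.
    by rewrite ler_pdivrMr // mul1r ler_nat.
  have kn0 : 0 <= k%:R / n%:R :> R by rewrite divr_ge0 ?ler0n.
  apply: le_trans (fK _ _ _ _) _.
  - rewrite /= in_itv /= /node lerDl mulr_ge0 ?(ltW ba_gt0) //=.
    by rewrite -lerBrDl ler_piMr // ltW.
  - by [].
  rewrite le_eqVlt; apply/orP; left; apply/eqP; rewrite /C /node [in LHS]xE.
  by field; rewrite gt_eqF.
apply: le_trans (casteljau_approx t01 node_le) _.
(* The centre d = n t is the binomial mean, so only the variance n t (1 - t) remains. *)
rewrite subrr expr0n add0r [leRHS](splitr e) lerD2l.
apply: le_trans C_le.
have -> : C / n%:R ^+ 2 * (n%:R * t * (1 - t)) = C / n%:R * (t * (1 - t)).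
  by field; rewrite gt_eqF.
case/andP: t01 => t0 t1; rewrite ler_piMr ?divr_ge0 ?ler0n //.
by rewrite mulr_ile1 ?subr_ge0 // gerBl.
Qed.

End Weierstrass.

(** * Integration against the weight *)

Section RealIntegrals.
Context d (T : measurableType d) (R : realType).
Variables (mu : {measure set T -> \bar R}) (D : set T).
Hypothesis mD : measurable D.

Lemma integrable_sum_EFin (I : Type) (s : seq I) (f : I -> T -> R) :
    (forall i, mu.-integrable D (EFin \o f i)) ->
  mu.-integrable D (EFin \o (fun x => \sum_(i <- s) f i x)).
Proof.
move=> fi; have -> : EFin \o (fun x => \sum_(i <- s) f i x) =
    (fun x => \sum_(i <- s) (EFin \o f i) x)%E.
  by apply/funext => x /=; rewrite sumEFin.
by apply: integrable_sum => // i _; apply: fi.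
Qed.

Lemma Rintegral_sum (I : Type) (s : seq I) (f : I -> T -> R) :
    (forall i, mu.-integrable D (EFin \o f i)) ->
  \int[mu]_(x in D) (\sum_(i <- s) f i x) =
  \sum_(i <- s) \int[mu]_(x in D) f i x.
Proof.
move=> fi; elim: s => [|i s IHs].
  by under eq_Rintegral do rewrite big_nil; rewrite big_nil Rintegral_cst // mul0r.
under eq_Rintegral do rewrite big_cons.
by rewrite big_cons RintegralD ?IHs //; apply: integrable_sum_EFin.
Qed.

(** On D, f agrees almost everywhere with its absolute value. *)
Lemma ae_Rintegral_ge0 (f : T -> R) :
    mu.-integrable D (EFin \o f) -> {ae mu, forall x, D x -> 0 <= f x} ->
  0 <= \int[mu]_(x in D) f x.
Proof.
move=> fi f_ge0; have [mf _] := integrableP _ _ _ fi.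
have -> : \int[mu]_(x in D) f x = \int[mu]_(x in D) `|f x|.
  congr fine; apply: ae_eq_integral => //.
    by have [] := integrableP _ _ _ (integrable_norm fi).
  by apply: filterS f_ge0 => x f0 Dx; rewrite ger0_norm // f0.
by apply: Rintegral_ge0.
Qed.

Variable w : T -> R.
Hypothesis wi : mu.-integrable D (EFin \o w).

Definition bounded_measurable (f : T -> R) :=
  measurable_fun D f /\ [bounded f x | x in D].

Lemma weighted_integrable f : bounded_measurable f ->
  mu.-integrable D (EFin \o (fun x => f x * w x)).
Proof. by case=> mf bf; exact: (integrableMr mD mf bf wi). Qed.

Lemma weighted_Rintegral_dist f g (e : R) :
    bounded_measurable f -> bounded_measurable g ->
    (forall x, D x -> `|f x - g x| <= e) ->
  `|\int[mu]_(x in D) (f x * w x) - \int[mu]_(x in D) (g x * w x)| <=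
    e * \int[mu]_(x in D) `|w x|.
Proof.
move=> f_bm g_bm fg.
have fwi := weighted_integrable f_bm; have gwi := weighted_integrable g_bm.
have fgi := integrableB mD fwi gwi.
rewrite -RintegralB //; apply: le_trans (le_normr_Rintegral mD fgi) _.
have nwi := integrable_norm wi.
rewrite -RintegralZl //; apply: le_Rintegral => //.
- exact: integrable_norm.
- exact: (integrableZl mD e nwi).
by move=> x Dx; rewrite -mulrBl normrM ler_wpM2r // fg.
Qed.

End RealIntegrals.

(** * From Borel sets to the completed Lebesgue measure *)

Section CompletedLebesgue.
Variables (R : realType) (a b : R).
Local Notation mu := (@completed_lebesgue_measure R).
Local Notation I := (`[a, b]%classic : set (caratheodory_type (wlength idfun)^*%mu)).

Lemma measurable_caratheodory (A : set R) :
  measurable A -> measurable (A : set (caratheodory_type (wlength (@idfun R))^*%mu)).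
Proof. exact: sub_caratheodory. Qed.

Lemma continuous_bounded_measurable (f : R -> R) :
  {within `[a, b], continuous f} -> bounded_measurable I f.
Proof.
move=> f_cont; split.
  have := subspace_continuous_measurable_fun (measurable_itv `[a, b]) f_cont.
  by move=> mf mI Y mY; apply: measurable_caratheodory; apply: mf.
have /compact_bounded[M [Mr fM]] :=
  continuous_compact f_cont (@segment_compact _ a b).
by exists M; split=> // x Mx y Iy; apply: fM => //; exists y.
Qed.

End CompletedLebesgue.

(** * Moments of the weight matrix *)

Section WeightedMoments.
Variables (R : realType) (p : nat) (a b : R) (W : R -> 'M[R]_p).
Hypothesis hW : weight_matrix a b W.
Local Notation mu := (@completed_lebesgue_measure R).

Definition weight_integral i j (f : R -> R) : R :=
  \int[mu]_(t in `[a, b]) (f t * W t i j).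

Let mI : measurable (`[a, b]%classic : set (caratheodory_type (wlength idfun)^*%mu)).
Proof. by apply: measurable_caratheodory; exact: measurable_itv. Qed.

Let weight_integrable_cont i j (f : R -> R) :
  {within `[a, b], continuous f} ->
  mu.-integrable `[a, b] (EFin \o (fun t => f t * W t i j)).
Proof.
move=> /continuous_bounded_measurable f_bm.
exact: (weighted_integrable mI (weight_integrable hW i j) f_bm).
Qed.

Let continuous_poly (q : {poly R}) : {within `[a, b], continuous (horner q)}.
Proof. by apply: continuous_subspaceT; apply: continuous_horner. Qed.

Lemma weight_integral_dist i j (f g : R -> R) (e : R) :
    {within `[a, b], continuous f} -> {within `[a, b], continuous g} ->
    (forall x, x \in `[a, b] -> `|f x - g x| <= e) ->
  `|weight_integral i j f - weight_integral i j g| <=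
    e * \int[mu]_(t in `[a, b]) `|W t i j|.
Proof.
move=> /continuous_bounded_measurable f_bm /continuous_bounded_measurable g_bm.
exact: (weighted_Rintegral_dist mI (weight_integrable hW i j) f_bm g_bm).
Qed.

Lemma weight_moment_scalar i j :
  scalar (fun q : {poly R} => weight_integral i j (horner q)).
Proof.
move=> c q r; rewrite /weight_integral.
have qi := weight_integrable_cont i j (@continuous_poly q).
have ri := weight_integrable_cont i j (@continuous_poly r).
rewrite -RintegralZl // -RintegralD //; last exact: (integrableZl mI c qi).
by apply: eq_Rintegral => x _; rewrite !hornerE mulrDl.
Qed.

(** Bundled with its linearity, to serve as the functional L_ij of the algebraic part. *)
Definition weight_moment i j : {scalar {poly R}} :=
  HB.pack (fun q : {poly R} => weight_integral i j (horner q))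
    (GRing.isLinear.Build _ _ _ _ _ (weight_moment_scalar i j)).

Lemma weight_moment_sym i j : weight_moment i j =1 weight_moment j i.
Proof.
move=> q; apply: eq_Rintegral => x; rewrite inE /= => xI; congr (_ * _).
by rewrite -{1}(weight_sym hW xI) mxE.
Qed.

Lemma weight_moment1 i : weight_moment i i 1 = 1.
Proof.
have /matrixP/(_ i i) := weight_normalized hW; rewrite !mxE eqxx mulr1n => <-.
by apply: eq_Rintegral => x _; rewrite hornerC mul1r.
Qed.

(** Reduces matrix integrals to scalar ones, both for the orthonormality relations and for the
    limit. *)
Lemma mxintegral_weight (F G : R -> 'M[R]_p) :
    (forall i j, {within `[a, b], continuous (fun x => F x i j)}) ->
    (forall i j, {within `[a, b], continuous (fun x => G x i j)}) ->
  mxintegral a b (fun x => F x *m W x *m (G x)^T) =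
  \matrix_(r, s) \sum_i \sum_j
    weight_integral i j (fun x => F x r i * G x s j).
Proof.
move=> F_cont G_cont; apply/matrixP => r s; rewrite !mxE.
have FGi i j : mu.-integrable `[a, b] (EFin \o (fun t => F t r i * G t s j * W t i j)).
  apply: weight_integrable_cont => x; apply: continuousM.
    exact: F_cont.
  exact: G_cont.
transitivity (\int[mu]_(t in `[a, b])
    (\sum_i \sum_j F t r i * G t s j * W t i j)).
  apply: eq_Rintegral => x _; rewrite mxE.
  under eq_bigr do rewrite !mxE mulr_suml.
  rewrite exchange_big; apply: eq_bigr => i _; apply: eq_bigr => j _ /=.
  by rewrite mulrAC.
rewrite Rintegral_sum // => [|i]; last exact: integrable_sum_EFin.
by apply: eq_bigr => i _; rewrite Rintegral_sum.
Qed.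

Lemma mxp_form_weight_moment (A B : 'M[{poly R}]_p) :
  mxp_form weight_moment A B =
  mxintegral a b (fun x => mxpeval A x *m W x *m (mxpeval B x)^T).
Proof.
have ev_cont (C : 'M[{poly R}]_p) i j :
    {within `[a, b], continuous (fun x => mxpeval C x i j)}.
  have -> : (fun x => mxpeval C x i j) = horner (C i j).
    by apply/funext => x; rewrite mxE.
  exact: continuous_poly.
rewrite mxintegral_weight //; apply/matrixP => r s; rewrite !mxE.
apply: eq_bigr => i _; apply: eq_bigr => j _; apply: eq_Rintegral => x _.
by rewrite !mxE hornerM.
Qed.

(** The integrand is h(x) q(x) W(x) q(x)^T, nonnegative almost everywhere. Taking h = X - a and h =
    b - X gives a <= X <= b in the form. *)
Lemma mxp_form_weight_ge0 (h : {poly R}) (q : 'rV[{poly R}]_p) :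
    (forall x, x \in `[a, b] -> 0 <= h.[x]) ->
  0 <= mxp_form weight_moment (h *: q) q 0 0.
Proof.
move=> h_ge0; rewrite mxE.
have qi i j : mu.-integrable `[a, b]
    (EFin \o (fun t => ((h *: q) 0 i * q 0 j).[t] * W t i j)).
  exact/weight_integrable_cont/continuous_poly.
under eq_bigr do rewrite -Rintegral_sum //.
rewrite -Rintegral_sum // => [|i]; last exact: integrable_sum_EFin.
apply: ae_Rintegral_ge0 => //.
  by apply: integrable_sum_EFin => // i; apply: integrable_sum_EFin.
have aeF : Filter (almost_everywhere mu) by exact: (ae_filter_ringOfSetsType mu).
apply: filterS (weight_psd_ae hW) => x Wx xI; have [W_psd _] := Wx xI.
have := W_psd (\col_i (q 0 i).[x]); rewrite mxE.
under eq_bigr do rewrite !mxE mulr_suml.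
rewrite exchange_big /= => /(mulr_ge0 (h_ge0 x xI)); rewrite mulr_sumr.
congr (0 <= _); apply: eq_bigr => i _; rewrite mulr_sumr.
by apply: eq_bigr => j _; rewrite !mxE !hornerE /= mulrAC.
Qed.

End WeightedMoments.

(** * Convergence *)

Section GaussConvergence.
Variables (R : realType) (p : nat) (a b : R).
Hypothesis ab : a < b.
Variable W : R -> 'M[R]_p.
Hypothesis hW : weight_matrix a b W.
Variable P : nat -> 'M[{poly R}]_p.
Hypothesis hP : orthonormal_mxpoly a b W P.
Variable zeros : nat -> seq R.
Hypothesis zeros_uniq : forall n, (1 <= n)%N -> uniq (zeros n).
Hypothesis zerosE : forall n (x : R), (1 <= n)%N ->
  (x \in zeros n) = root (\det (P n)) x.
Variable V : forall (n : nat) (x : R), 'M[R]_(p, zero_mult P n x).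
Hypothesis V_null : forall n (x : R), (1 <= n)%N -> x \in zeros n ->
  zero_vectors (V n x).

Local Notation Lam n x := (gauss_coef P n x (V n x)).
Local Notation L := (weight_moment hW).

Let L_sym := weight_moment_sym hW.

Let P_orth n m : mxp_form L (P n) (P m) = (n == m)%:R%:M.
Proof. by rewrite mxp_form_weight_moment (onp_orthonormal hP). Qed.

Let zeros_itv n x : x \in zeros n.+1 -> x \in `[a, b].
Proof.
rewrite zerosE // in_itv /=.
apply: (zero_in_itv L_sym (onp_degree hP) (onp_lead hP) P_orth) => // q.
  have := mxp_form_weight_ge0 hW (h := 'X - a%:P) q.
  rewrite scalerBl mxp_formBl mxp_formZl !mxE subr_ge0; apply=> y.
  by rewrite in_itv /= => /andP[ay _]; rewrite !hornerE subr_ge0.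
have := mxp_form_weight_ge0 hW (h := b%:P - 'X) q.
rewrite scalerBl mxp_formBl mxp_formZl !mxE subr_ge0; apply=> y.
by rewrite in_itv /= => /andP[_ yb]; rewrite !hornerE subr_ge0.
Qed.

Let exact_entry n i j (q : {poly R}) : (size q <= n.+1)%N ->
  \sum_(x <- zeros n.+1) q.[x] * Lam n.+1 x i j = L i j q.
Proof.
move=> sq; have := gauss_quadrature_exact L_sym (onp_degree hP) (onp_lead hP)
  P_orth (zeros_uniq (ltn0Sn n)) (fun x => zerosE x (ltn0Sn n))
  (fun x => @V_null n.+1 x (ltn0Sn n)) sq.
move=> /matrixP/(_ i j); rewrite mxE summxE => <-.
by apply: eq_bigr => x _; rewrite [RHS]mxE.
Qed.

Let sum_Lam_le n i j : \sum_(x <- zeros n.+1) `|Lam n.+1 x i j| <= 1.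
Proof.
have := sum_gauss_coef_le L_sym (onp_degree hP) (onp_lead hP)
  P_orth (zeros_uniq (ltn0Sn n)) (fun x => zerosE x (ltn0Sn n))
  (fun x => @V_null n.+1 x (ltn0Sn n)) i j.
by rewrite !weight_moment1 -mulr2n divff ?pnatr_eq0.
Qed.

(** For a polynomial q within d of f, replacing f by q costs at most d C in the integral and d in
    the quadrature sum; the two agree on q once n >= [size q]. *)
Lemma gauss_quadrature_cvg i j (f : R -> R) :
    {within `[a, b], continuous f} ->
  (fun n => \sum_(x <- zeros n) f x * Lam n x i j) @ \oo -->
    weight_integral a b W i j f.
Proof.
move=> f_cont; apply/cvgrPdist_le => e e_gt0.
set C := \int[completed_lebesgue_measure]_(t in `[a, b]) `|W t i j|.
have C_ge0 : 0 <= C by apply: Rintegral_ge0.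
have C1_gt0 : 0 < C + 1 by rewrite ltr_wpDl.
(* Chosen so that d C + d = e; the added 1 covers C = 0. *)
pose d := e / (C + 1); have d_gt0 : 0 < d by rewrite divr_gt0.
have [q fq] := weierstrass ab f_cont d_gt0.
have q_cont : {within `[a, b], continuous (horner q)}.
  by apply: continuous_subspaceT; apply: continuous_horner.
suff bound n : (0 < n)%N -> (size q <= n)%N ->
    `|weight_integral a b W i j f - \sum_(x <- zeros n) f x * Lam n x i j| <= e.
  by near=> n; apply: bound; near: n; apply: nbhs_infty_ge.
case: n => // n _ sq.
rewrite -[_ - _](subrKA (weight_integral a b W i j (horner q))).
apply: le_trans (ler_normD _ _) _.
have -> : e = d * C + d * 1 by rewrite -mulrDr /d divfK // gt_eqF.
apply: lerD; first exact: weight_integral_dist.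
have -> : weight_integral a b W i j (horner q) =
  \sum_(x <- zeros n.+1) q.[x] * Lam n.+1 x i j by rewrite exact_entry.
rewrite -sumrB; apply: le_trans (ler_norm_sum _ _ _) _.
apply: le_trans (ler_wpM2l (ltW d_gt0) (sum_Lam_le n i j)).
rewrite mulr_sumr big_seq [leRHS]big_seq; apply: ler_sum => x zx.
by rewrite -mulrBl normrM ler_wpM2r // distrC fq // (zeros_itv zx).
Unshelve. all: by end_near. Qed.

End GaussConvergence.

(** * Entrywise limits and the matrix statement *)

Lemma cvg_sumr (R : realType) (T I : Type) (F : set_system T) (r : seq I)
    (f : I -> T -> R) (l : I -> R) : Filter F ->
  (forall i, f i @ F --> l i) ->
  (fun x => \sum_(i <- r) f i x) @ F --> \sum_(i <- r) l i.
Proof.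
by move=> FF fl; apply: cvg_big => [|i _]; [exact: add_continuous | exact: fl].
Qed.

(** A neighbourhood of a matrix contains a product of neighbourhoods of its finitely many
    entries. *)
Lemma cvg_mxP (R : realType) (T : Type) (F : set_system T) m n
    (f : T -> 'M[R]_(m, n)) (A : 'M[R]_(m, n)) : Filter F ->
  (forall i j, (fun t => f t i j) @ F --> A i j) -> f @ F --> A.
Proof.
move=> FF fA S [Q AQ QS]; apply: (filterS QS).
by apply: filter_forall => i; apply: filter_forall => j; apply: fA; apply: AQ.
Qed.

Lemma within_continuous_coord (R : realType) (A : set R) m n
    (F : R -> 'M[R]_(m, n)) i j :
  {within A, continuous F} -> {within A, continuous (fun x => F x i j)}.
Proof.
move=> F_cont x; apply: (@continuous_comp _ _ _ (F : subspace A -> _)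
  (fun M : 'M[R]_(m, n) => M i j)).
  exact: F_cont.
exact: coord_continuous.
Qed.

Theorem theorem5p3 (R : realType) (p : nat) (p_gt0 : (0 < p)%N)
    (a b : R) (ab : a < b)
    (W : R -> 'M[R]_p) (hW : weight_matrix a b W)
    (F G : R -> 'M[R]_p)
    (hF : {within `[a, b], continuous F}) (hG : {within `[a, b], continuous G})
    (P : nat -> 'M[{poly R}]_p) (hP : orthonormal_mxpoly a b W P)
    (zeros : nat -> seq R)
    (hz_uniq : forall n : nat, (1 <= n)%N -> uniq (zeros n))
    (hz : forall (n : nat) (x : R), (1 <= n)%N ->
       (x \in zeros n) = root (\det (P n)) x)
    (V : forall (n : nat) (x : R), 'M[R]_(p, zero_mult P n x))
    (hV : forall (n : nat) (x : R), (1 <= n)%N -> x \in zeros n ->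
       zero_vectors (V n x)) :
  (fun n : nat =>
     \sum_(x <- zeros n) F x *m gauss_coef P n x (V n x) *m (G x)^T)
    @ \oo --> mxintegral a b (fun x => F x *m W x *m (G x)^T).
Proof.
have Fc i j := within_continuous_coord (i := i) (j := j) hF.
have Gc i j := within_continuous_coord (i := i) (j := j) hG.
rewrite mxintegral_weight //; apply: cvg_mxP => r s; rewrite mxE.
(* Each entry is a finite sum of scalar quadratures of the functions F_ri G_sj with coefficients
   (Lambda_x)_ij. *)
have -> : (fun n => (\sum_(x <- zeros n)
      F x *m gauss_coef P n x (V n x) *m (G x)^T) r s) =
    (fun n => \sum_i \sum_j \sum_(x <- zeros n)
      F x r i * G x s j * gauss_coef P n x (V n x) i j).
  apply/funext => n; rewrite summxE.
  under [RHS]eq_bigr do rewrite exchange_big.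
  rewrite exchange_big; apply: eq_bigr => x _ /=.
  move: (gauss_coef _ _ _ _) => A; rewrite mxE.
  transitivity (\sum_j \sum_i F x r i * A i j * G x s j).
    by apply: eq_bigr => j _; rewrite !mxE mulr_suml.
  rewrite exchange_big; apply: eq_bigr => i _; apply: eq_bigr => j _ /=.
  by rewrite mulrAC.
apply: cvg_sumr => i; apply: cvg_sumr => j.
apply: (gauss_quadrature_cvg ab hW hP) => // x.
by apply: continuousM; [exact: Fc | exact: Gc].
Qed.
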